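(* Let $H$ be a $\mathbb Z$-lattice of rank $n\in\mathbb N$ and let $h:H\to H$ be an endomorphism. Let $p_1,\dots,p_k\in\mathbb Z[t]$ be the elementary divisors of the $\mathbb Q[t]$-module $H_{\mathbb Q}=H\otimes_{\mathbb Z}\mathbb Q$ (with $t$ acting as $h$), that is, the unique monic polynomials of degree $\geq 1$ with $p_k\mid p_{k-1}\mid\dots\mid p_2\mid p_1$ and $H_{\mathbb Q}\cong\bigoplus_{j=1}^k\mathbb Q[t]/p_j\mathbb Q[t]$ as $\mathbb Q[t]$-modules. Let $a^{[1]}_0,\dots,a^{[k]}_0\in H$ and put $a^{[j]}_i:=h^i(a^{[j]}_0)$ for $i\in\mathbb Z_{\geq 0}$. Suppose that the tuple $$(a^{[j]}_i\mid j=1,\dots,k,\ i=0,\dots,\deg p_j-1)$$ is a $\mathbb Z$-basis of $H$. Then $(H,h)$ admits a standard decomposition $H=\bigoplus_{j=1}^kB^{[j]}$ into companion blocks $B^{[j]}$. The companion blocks can be chosen as follows: $B^{[1]}$ has characteristic polynomial $p_1$ and is generated by $a^{[1]}_0$; for $j\in\{2,\dots,k\}$ the block $B^{[j]}$ has characteristic polynomial $p_j$ and is generated by $a^{[j]}_0+b^{[j]}$, where $b^{[j]}$ is a certain element of $B^{[1]}+\dots+B^{[j-1]}$.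
   Context: A $\mathbb Z$-lattice is a free $\mathbb Z$-module of finite rank. For a $\mathbb Z$-lattice $H$ of rank $n\in\mathbb N=\{1,2,\dots\}$ with endomorphism $h$, $p_{H,h}$ is the characteristic polynomial. The elementary divisors above are automatically in $\mathbb Z[t]$ and satisfy $p_{H,h}=p_1\cdots p_k$. $(H,h)$ is a companion block if there is $a_0\in H$ (called a generating element; one says that $a_0$ generates the companion block) with $H=\bigoplus_{j=0}^{n-1}\mathbb Z\cdot h^j(a_0)$. An $h$-invariant sublattice $H^{(1)}\subset H$ is a companion block if $(H^{(1)},h|_{H^{(1)}})$ is one. A decomposition $H=\bigoplus_{i=1}^kH^{(i)}$ into companion blocks is standard if $p_{H^{(k)},h}\mid p_{H^{(k-1)},h}\mid\dots\mid p_{H^{(1)},h}$. *)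

(* Defs.v *)
From HB Require Import structures.
From mathcomp Require Import all_boot all_order all_algebra.
From mathcomp Require Import qpoly.

Set Implicit Arguments.
Unset Strict Implicit.
Unset Printing Implicit Defensive.

Import Order.TTheory GRing.Theory Num.Theory.
Import VectorInternalTheory.
Local Open Scope ring_scope.

(* V as an R[t]-module, the variable t acting as f. *)
Definition tmodule (R : comNzRingType) (V : lmodType R) (f : {linear V -> V}) :
  Type := V.

Section TModule.
Variables (R : comNzRingType) (V : lmodType R) (f : {linear V -> V}).
Local Notation M := (tmodule f).

HB.instance Definition _ := GRing.Zmodule.copy M V.

Definition tscale (p : {poly R}) (v : M) : M :=
  \sum_(i < size p) p`_i *: iter i f (v : V).

Lemma tscale_widen n (p : {poly R}) (v : V) : (size p <= n)%N ->
  tscale p v = \sum_(i < n) p`_i *: iter i f v.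
Proof.
move=> le_pn; rewrite /tscale (big_ord_widen n (fun i => p`_i *: iter i f v)) //.
rewrite big_mkcond; apply: eq_bigr => i _.
by case: ltnP => // le_pi; rewrite nth_default ?scale0r.
Qed.

Lemma tscaleDl (v : M) : {morph tscale^~ v : p q / p + q}.
Proof.
move=> p q; set n := maxn (size p) (size q).
rewrite (@tscale_widen n (p + q)) ?size_polyD //.
rewrite (@tscale_widen n p) ?leq_maxl // (@tscale_widen n q) ?leq_maxr //.
by rewrite -big_split; apply: eq_bigr => i _; rewrite coefD scalerDl.
Qed.

Lemma iter_linear i a (u v : V) :
  iter i f (a *: u + v) = a *: iter i f u + iter i f v.
Proof. by elim: i => // i IHi; rewrite !iterS IHi linearP. Qed.

Lemma tscaleDr : right_distributive tscale +%R.
Proof.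
move=> p u v; rewrite -big_split; apply: eq_bigr => i _ /=.
by rewrite -[u + v]/((u : V) + (v : V)) -[u : V]scale1r iter_linear !scale1r scalerDr.
Qed.

Lemma tscaleC c (v : V) : tscale c%:P v = c *: v.
Proof.
by rewrite (@tscale_widen 1) ?size_polyC_leq1 // big_ord1 coefC.
Qed.

Lemma tscaleMX p (v : V) : tscale (p * 'X) v = f (tscale p v).
Proof.
have [->|p0] := eqVneq p 0; first by rewrite mul0r /tscale size_poly0 !big_ord0 linear0.
rewrite {1}/tscale size_mulX // big_ord_recl coefMX scale0r add0r linear_sum.
by apply: eq_bigr => i _; rewrite coefMX /= linearZ.
Qed.

Lemma tscaleX (v : V) : tscale 'X v = f v.
Proof. by rewrite -['X]mul1r tscaleMX tscaleC scale1r. Qed.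

Lemma tscaleZ c p (v : V) : tscale (c *: p) v = c *: (tscale p v : V).
Proof.
rewrite (@tscale_widen (size p)) ?size_scale_leq // scaler_sumr.
by apply: eq_bigr => i _; rewrite coefZ scalerA.
Qed.

Lemma tscaleA p q v : tscale p (tscale q v) = tscale (p * q) v.
Proof.
elim/poly_ind: p => [|p c IHp]; first by rewrite mul0r /tscale size_poly0 !big_ord0.
rewrite mulrDl !tscaleDl tscaleC mul_polyC tscaleZ.
by rewrite tscaleMX IHp -mulrA ['X * q]mulrC mulrA tscaleMX.
Qed.

Lemma tscale1 : left_id 1 tscale.
Proof. by move=> v; rewrite tscaleC scale1r. Qed.

HB.instance Definition _ := GRing.Zmodule_isLmodule.Build {poly R} M
  tscaleA tscale1 tscaleDr tscaleDl.

End TModule.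

(* A[t] / p A[t] as an A[t]-module. This is the expected quotient when p is
   monic of degree at least 1; otherwise {poly %/ p} is A[t] / t A[t]. *)
Definition qmodule (A : comNzRingType) (p : {poly A}) : Type := {poly %/ p}.

Section QModule.
Variables (A : comNzRingType) (p : {poly A}).
Local Notation M := (qmodule p).

HB.instance Definition _ := GRing.Zmodule.copy M {poly %/ p}.

Definition qscale (q : {poly A}) (x : M) : M := in_qpoly p q * (x : {poly %/ p}).

Lemma qscaleA q r x : qscale q (qscale r x) = qscale (q * r) x.
Proof. by rewrite /qscale mulrA rmorphM. Qed.

Lemma qscale1 : left_id 1 qscale.
Proof. by move=> x; rewrite /qscale rmorph1 mul1r. Qed.

Lemma qscaleDr : right_distributive qscale +%R.
Proof. by move=> q x y; rewrite /qscale mulrDr. Qed.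

Lemma qscaleDl (x : M) : {morph qscale^~ x : q r / q + r}.
Proof. by move=> q r; rewrite /qscale rmorphD mulrDl. Qed.

HB.instance Definition _ := GRing.Zmodule_isLmodule.Build {poly A} M
  qscaleA qscale1 qscaleDr qscaleDl.

End QModule.

(* External direct sum of a finite family of modules. *)
Definition dsum (R : nzRingType) (I : finType) (M : I -> lmodType R) : Type :=
  {dffun forall i, M i}.

Section DirectSum.
Variables (R : nzRingType) (I : finType) (M : I -> lmodType R).
Local Notation S := (dsum M).
Implicit Types x y z : S.

HB.instance Definition _ := Choice.copy S {dffun forall i, M i}.

Definition dsum_mk (g : forall i, M i) : S := [ffun i => g i].
Definition dsum_zero : S := dsum_mk (fun=> 0).
Definition dsum_opp x : S := dsum_mk (fun i => - x i).
Definition dsum_add x y : S := dsum_mk (fun i => x i + y i).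
Definition dsum_scale (a : R) x : S := dsum_mk (fun i => a *: x i).

Lemma dsum_addA : associative dsum_add.
Proof. by move=> x y z; apply/ffunP => i; rewrite !ffunE addrA. Qed.

Lemma dsum_addC : commutative dsum_add.
Proof. by move=> x y; apply/ffunP => i; rewrite !ffunE addrC. Qed.

Lemma dsum_add0 : left_id dsum_zero dsum_add.
Proof. by move=> x; apply/ffunP => i; rewrite !ffunE add0r. Qed.

Lemma dsum_addN : left_inverse dsum_zero dsum_opp dsum_add.
Proof. by move=> x; apply/ffunP => i; rewrite !ffunE addNr. Qed.

HB.instance Definition _ :=
  GRing.isZmodule.Build S dsum_addA dsum_addC dsum_add0 dsum_addN.

Lemma dsum_scaleA a b x : dsum_scale a (dsum_scale b x) = dsum_scale (a * b) x.
Proof. by apply/ffunP => i; rewrite !ffunE scalerA. Qed.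

Lemma dsum_scale1 : left_id 1 dsum_scale.
Proof. by move=> x; apply/ffunP => i; rewrite !ffunE scale1r. Qed.

Lemma dsum_scaleDr : right_distributive dsum_scale +%R.
Proof. by move=> a x y; apply/ffunP => i; rewrite !ffunE scalerDr. Qed.

Lemma dsum_scaleDl x : {morph dsum_scale^~ x : a b / a + b}.
Proof. by move=> a b; apply/ffunP => i; rewrite !ffunE scalerDl. Qed.

HB.instance Definition _ := GRing.Zmodule_isLmodule.Build R S
  dsum_scaleA dsum_scale1 dsum_scaleDr dsum_scaleDl.

End DirectSum.

(* The index j = 1, .., k of the mathematics is the ordinal j - 1 : 'I_k. *)
Definition elementary_divisors (F : fieldType) (M : lmodType {poly F})
    (k : nat) (p : 'I_k -> {poly F}) : Prop :=
  [/\ forall j, (p j \is monic) && (1 < size (p j))%N,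
      forall i j : 'I_k, (i <= j)%N -> p j %| p i
    & exists f : {linear M -> dsum (fun j => qmodule (p j))}, bijective f].

(* H (x) Q for a lattice H, in the coordinates of H : vectType int; that it is
   the extension of scalars is ratext_universal below. *)
Definition ratext (H : vectType int) := 'rV[rat]_(dim H).

Section RatExt.
Variable H : vectType int.

Definition ratext_in (x : H) : ratext H := map_mx intr (v2r x).

Definition ratext_map (h : {linear H -> H}) : {linear ratext H -> ratext H} :=
  mulmxr (map_mx intr (lin1_mx (v2r \o h \o r2v))).

Lemma ratext_mapE h x : ratext_map h (ratext_in x) = ratext_in (h x).
Proof.
by rewrite /ratext_map /ratext_in /= -map_mxM mul_rV_lin1 /= v2rK.
Qed.

Lemma ratext_in_is_zmod_morphism : zmod_morphism ratext_in.
Proof. by move=> x y; rewrite /ratext_in linearB map_mxB. Qed.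

HB.instance Definition _ :=
  GRing.isZmodMorphism.Build H (ratext H) ratext_in ratext_in_is_zmod_morphism.

Lemma ratext_universal (W : lmodType rat) (g : {additive H -> W}) :
  exists2 G : {linear ratext H -> W},
    forall x, G (ratext_in x) = g x
  & forall G' : {linear ratext H -> W},
      (forall x, G' (ratext_in x) = g x) -> G' =1 G.
Proof.
pose b i : H := r2v (delta_mx 0 i).
pose G (u : ratext H) : W := \sum_i u 0 i *: g (b i).
have G_lin : linear G.
  move=> a u v; rewrite scaler_sumr -big_split; apply: eq_bigr => i _ /=.
  by rewrite !mxE scalerDl scalerA.
pose GL := GRing.isLinear.Build rat (ratext H) W *:%R G G_lin.
pose G1 : {linear ratext H -> W} := HB.pack G GL.
have inb i : ratext_in (b i) = delta_mx 0 i.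
  by rewrite /ratext_in r2vK map_delta_mx.
have scalez (c : int) x : c *: x = x *~ c :> H by rewrite -scaler_int intz.
exists G1 => [x|G' G'E u].
  rewrite -[x in RHS]v2rK [v2r x in RHS]matrix_sum_delta big_ord1.
  rewrite !linear_sum raddf_sum; apply: eq_bigr => i _.
  by rewrite linearZ /= scalez raddfMz mxE scaler_int.
rewrite [u in LHS]matrix_sum_delta big_ord1 linear_sum.
by apply: eq_bigr => i _; rewrite linearZ -inb G'E.
Qed.

End RatExt.

Section Lattices.
Variables (H : vectType int) (h : {linear H -> H}).
Implicit Types (B : {pred H}) (a : H).

(* The family e is a Z-basis of the sublattice B. *)
Definition zbasis (I : finType) B (e : I -> H) : Prop :=
  (forall x, x \in B <-> exists c : I -> int, x = \sum_i c i *: e i) /\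
  (forall c : I -> int, \sum_i c i *: e i = 0 -> forall i, c i = 0).

(* q is the characteristic polynomial of the restriction of h to the
   h-invariant sublattice B. *)
Definition has_charpoly B (q : {poly int}) : Prop :=
  exists m (e : 'I_m -> H) (M : 'M[int]_m),
    [/\ zbasis B e,
        forall i, h (e i) = \sum_j M i j *: e j
      & q = char_poly M].

Lemma zbasis_eq (I : finType) B (e : I -> H) (c d : I -> int) : zbasis B e ->
  \sum_i c i *: e i = \sum_i d i *: e i -> c =1 d.
Proof.
move=> [_ free_e] eq_cd i; apply/eqP; rewrite -subr_eq0; apply/eqP.
apply: (free_e (fun i => c i - d i)).
under eq_bigr do rewrite scalerBl.
by rewrite sumrB eq_cd subrr.
Qed.

Lemma zbasis_mx B m n (e : 'I_m -> H) (f : 'I_n -> H) :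
  zbasis B e -> zbasis B f ->
  exists P : 'M[int]_(n, m), forall i, f i = \sum_j P i j *: e j.
Proof.
move=> [eB _] [fB _].
have fP i : exists c : {ffun 'I_m -> int}, f i == \sum_j c j *: e j.
  have /eB[c fE] : f i \in B.
    apply/fB; exists (fun j => (j == i)%:R).
    by rewrite (bigD1 i) //= eqxx scale1r big1 ?addr0 // => j /negPf->; rewrite scale0r.
  by exists (finfun c); rewrite fE; apply/eqP/eq_bigr => j _; rewrite ffunE.
exists (\matrix_(i, j) xchoose (fP i) j) => i.
by rewrite {1}(eqP (xchooseP (fP i))); apply: eq_bigr => j _; rewrite mxE.
Qed.

Lemma zcomb_mulmx m n r (e : 'I_m -> H) (f : 'I_n -> H)
    (P : 'M[int]_(n, m)) (N : 'M[int]_(r, n)) :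
  (forall i, f i = \sum_j P i j *: e j) ->
  forall i, \sum_j N i j *: f j = \sum_j (N *m P) i j *: e j.
Proof.
move=> fE i; under eq_bigr do rewrite fE scaler_sumr.
rewrite exchange_big; apply: eq_bigr => j _ /=.
by rewrite mxE scaler_suml; apply: eq_bigr => l _; rewrite scalerA.
Qed.

Lemma zbasis_inv B m n (e : 'I_m -> H) (f : 'I_n -> H)
    (P : 'M[int]_(n, m)) (Q : 'M[int]_(m, n)) : zbasis B e ->
  (forall i, f i = \sum_j P i j *: e j) ->
  (forall i, e i = \sum_j Q i j *: f j) -> Q *m P = 1%:M.
Proof.
move=> eb fE eE; apply/matrixP => i j; move: j; apply: (zbasis_eq eb).
rewrite -(zcomb_mulmx _ fE) -eE (bigD1 i) //= mxE eqxx scale1r big1 ?addr0 //.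
by move=> j /negPf ne_ji; rewrite mxE eq_sym ne_ji scale0r.
Qed.

Lemma leq_mulmx1 m n (P : 'M[int]_(n, m)) (Q : 'M[int]_(m, n)) :
  Q *m P = 1%:M -> (m <= n)%N.
Proof.
move/(congr1 (map_mx (intr : int -> rat))); rewrite map_mxM map_mx1 => QP.
by rewrite -(mxrank1 rat m) -QP (leq_trans (mxrankM_maxl _ _)) ?rank_leq_col.
Qed.

Lemma has_charpoly_unique B q r :
  has_charpoly B q -> has_charpoly B r -> q = r.
Proof.
move=> [m [e [M [eb hM ->]]]] [n [f [N [fb hN ->]]]].
have [P fE] := zbasis_mx eb fb; have [Q eE] := zbasis_mx fb eb.
have QP := zbasis_inv eb fE eE; have PQ := zbasis_inv fb eE fE.
have eq_mn : m = n by apply/eqP; rewrite eqn_leq (leq_mulmx1 QP) (leq_mulmx1 PQ).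
case: n / eq_mn in f N fb hN P fE Q eE QP PQ *.
have NP : N *m P = P *m M.
  apply/matrixP => i j; move: j; apply: (zbasis_eq eb).
  rewrite -(zcomb_mulmx _ fE) -hN fE linear_sum -(zcomb_mulmx _ hM).
  by apply: eq_bigr => j _; rewrite linearZ.
pose PX := map_mx (@polyC int) P.
have: char_poly_mx N *m PX = PX *m char_poly_mx M.
  rewrite /char_poly_mx mulmxBl mulmxBr -!map_mxM NP; congr (_ - _).
  by rewrite scalar_mxC.
move/(congr1 determinant); rewrite !det_mulmx mulrC.
have PX0 : \det PX != 0.
  rewrite det_map_mx polyC_eq0; apply/eqP => P0.
  by have /eqP := congr1 determinant PQ; rewrite det_mulmx P0 mul0r det1 eq_sym oner_eq0.
by move/(mulfI PX0).
Qed.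

Definition generates_block B a : Prop :=
  exists2 n, (0 < n)%N & zbasis B (fun i : 'I_n => iter i h a).

Definition companion_block B : Prop :=
  [/\ submod_closed B, forall x, x \in B -> h x \in B
    & exists a, generates_block B a].

(* H is the internal direct sum of the B j. *)
Definition direct_decomposition (k : nat) (B : 'I_k -> {pred H}) : Prop :=
  forall x, exists! y : {ffun 'I_k -> H},
    (forall j, y j \in B j) /\ x = \sum_j y j.

Definition standard_decomposition (k : nat) (B : 'I_k -> {pred H}) : Prop :=
  [/\ forall j, companion_block (B j),
      direct_decomposition B
    & exists2 q : 'I_k -> {poly int},
        forall j, has_charpoly (B j) (q j)
      & forall i j : 'I_k, (i <= j)%N -> exists r, q i = r * q j].

(* Membership in the sum of the B i with i < j. *)
Definition in_sum_before (k : nat) (B : 'I_k -> {pred H}) (j : 'I_k) (b : H) :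
  Prop :=
  exists2 y : 'I_k -> H, forall i, y i \in B i & b = \sum_(i < k | (i < j)%N) y i.

End Lattices.

(* Main.v *)
Require Import Defs.
From HB Require Import structures.
From mathcomp Require Import all_boot all_order all_algebra.
From mathcomp Require Import qpoly.

Set Implicit Arguments.
Unset Strict Implicit.
Unset Printing Implicit Defensive.

Import GRing.Theory.
Local Open Scope ring_scope.

(** Make H a Z[t]-module with t acting as h.  The hypothesis on the basis says
    that every element of H is uniquely a sum of f_j a_j with deg f_j < deg p_j.
    If in addition p_j a_j = 0 for all j, then Z[t] a_j is the Z-span of the
    a_j, .., h^(deg p_j - 1) a_j, it is a companion block on which h has the
    companion matrix of p_j, and H is the direct sum of these blocks.  So all
    that is needed is to make the generators annihilated by their p_j.

    This is done one index m at a time.  Suppose that p_i a_i = 0 for i < m.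
    Subtracting from a_m a combination of the a_i with i < m does not destroy
    the unique representation (poly_basis_shift), and the new generator is
    annihilated by p_m provided that p_m a_m lies in p_m S, where S is the sum
    of the Z[t] a_i with i < m (annihilated_mod_lower).

    That p_m a_m lies in p_m S after extending scalars to Q is a dimension
    count, and this is where the elementary divisors enter.  For i < m write
    p_i = q_i p_m.  In the sum of the Q[t]/p_i, an element is killed by p_m as
    soon as its i-th coordinate is divisible by q_i for each i < m; this is a
    system of sum_{i < m} deg q_i linear conditions.  The elements a_m and
    t^l a_i with i < m and l < deg q_i are one more in number, so some
    nontrivial combination c a_m + sum_i g_i a_i of them is killed by p_m
    (annihilated_relation).  Here c is not 0, since the p_m g_i have degree
    less than deg p_i and could not cancel.  Hence c p_m a_m lies in p_m S with
    c a nonzero integer.  Finally c can be removed: comparing representations,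
    the coordinates u_i of p_m a_m satisfy c u_i = - p_m g_i for i < m and are 0
    otherwise, and the monic polynomial p_m divides u_i over Z because it does
    so over Q. *)

Local Notation pZQ := (map_poly (intr : int -> rat)).

(** * Integer polynomials and integer relations *)

Lemma pZQ_monic (p : {poly int}) : (pZQ p \is monic) = (p \is monic).
Proof.
rewrite !monicE lead_coef_map_inj //; last exact: intr_inj.
by rewrite -[1 in LHS]/(1%:~R) eqr_int.
Qed.

Lemma size_pZQ (p : {poly int}) : size (pZQ p) = size p.
Proof. by rewrite size_map_inj_poly //; apply: intr_inj. Qed.

(** Euclidean division by a monic polynomial is the same over Z and over Q, so
    the integral remainder vanishes. *)
Lemma monic_dvdp_int (p u : {poly int}) :
  p \is monic -> pZQ p %| pZQ u -> exists w, u = w * p.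
Proof.
move=> p_monic; rewrite (Pdiv.RingMonic.rdivp_eq p_monic u).
set w := Pdiv.Ring.rdivp _ _; set s := Pdiv.Ring.rmodp _ _.
have lt_sp : (size s < size p)%N.
  by rewrite Pdiv.Ring.ltn_rmodpN0 ?monic_neq0.
rewrite rmorphD rmorphM dvdp_addr ?dvdp_mull // => /dvdp_leq.
rewrite !size_pZQ leqNgt lt_sp => s0; exists w.
suff -> : s = 0 by rewrite addr0.
apply/eqP; apply: contraTT isT => nz_s; apply: s0.
by rewrite -size_poly_eq0 size_pZQ size_poly_eq0.
Qed.

(** Used to pass between Z-linear combinations of x, h x, .., h^(n-1) x and
    multiples f x with deg f < n. *)
Definition poly_of_coefs n (c : 'I_n -> int) : {poly int} :=
  \sum_(l < n) c l *: 'X^l.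

Lemma coef_poly_of_coefs n (c : 'I_n -> int) (l : 'I_n) :
  (poly_of_coefs c)`_l = c l.
Proof.
rewrite coef_sum (bigD1 l) //= coefZ coefXn eqxx mulr1.
rewrite big1 ?addr0 // => l' ne_l.
by rewrite coefZ coefXn eq_sym (inj_eq val_inj) (negPf ne_l) mulr0.
Qed.

Lemma size_poly_of_coefs n (c : 'I_n -> int) :
  (size (poly_of_coefs c) <= n)%N.
Proof.
rewrite (leq_trans (size_sum _ _ _)) //; apply/bigmax_leqP => l _.
by rewrite (leq_trans (size_scale_leq _ _)) // size_polyXn.
Qed.

Lemma poly_of_coefs_id n (f : {poly int}) : (size f <= n)%N ->
  poly_of_coefs (fun l : 'I_n => f`_l) = f.
Proof.
move=> le_fn; rewrite /poly_of_coefs -(poly_def n (nth 0 f)); apply/polyP => l.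
rewrite coef_poly; case: ltnP => // /(leq_trans le_fn) le_fl.
by rewrite nth_default.
Qed.

(** Pigeonhole for linear systems: a rational solution exists by the rank
    bound, and clearing denominators makes it integral. *)
Lemma int_relation (I J : finType) (A : I -> J -> rat) : (#|J| < #|I|)%N ->
  exists2 v : I -> int, exists i, v i != 0 & forall j, \sum_i A i j *~ v i = 0.
Proof.
move=> ltJI; pose B := \matrix_(i < #|I|, j < #|J|) A (enum_val i) (enum_val j).
have /rowV0Pn[u /sub_kermxP uB nz_u] : kermx B != 0.
  rewrite kermx_eq0 /row_free neq_ltn.
  by rewrite (leq_ltn_trans (rank_leq_col _) ltJI).
have [q [d nz_d qE]] := rat_poly_scale (rVpoly u).
have{qE} uE i : u 0 i = d%:~R^-1 * (q`_i)%:~R.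
  by rewrite -coef_rVpoly_ord qE coefZ coef_map.
have nz_dQ : d%:~R != 0 :> rat by rewrite intr_eq0.
exists (fun i => q`_(enum_rank i)) => [|j].
  have [i nz_ui] := rV0Pn _ nz_u.
  exists (enum_val i); rewrite enum_valK; apply: contra nz_ui => /eqP qi.
  by rewrite uE qi mulr0.
have := congr1 (fun X : 'rV_ _ => d%:~R * X 0 (enum_rank j)) uB.
rewrite !mxE mulr0 mulr_sumr; apply: etrans.
rewrite [RHS](reindex (@enum_rank I)) /=; last exact/onW_bij/enum_rank_bij.
apply: eq_bigr => i _.
by rewrite uE mxE !enum_rankK mulrA mulVKf // mulrC mulrzr.
Qed.

(** * Correcting the generators of a Z[t]-module *)

Section PolyBasis.

Variables (M : lmodType {poly int}) (k : nat) (p : 'I_k -> {poly int}).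
Hypothesis p_monic : forall i, p i \is monic.
Implicit Types (a : 'I_k -> M) (x y : M) (i j m : 'I_k).

(** For monic p_i this amounts to the t^l a_i, l < deg p_i, being a Z-basis
    of M.  In general p_i a_i is not 0: t^(deg p_i) a_i may have components
    along every a_j. *)
Definition poly_basis a : Prop :=
  (forall x, exists2 f : 'I_k -> {poly int},
     forall i, (size (f i) < size (p i))%N & x = \sum_i f i *: a i) /\
  (forall f : 'I_k -> {poly int}, (forall i, (size (f i) < size (p i))%N) ->
     \sum_i f i *: a i = 0 -> forall i, f i = 0).

(** C abstracts the representatives in Q[t] of the coordinates in the sum of the
    Q[t]/p_i: r x vanishes there iff each p_i divides r C_i(x). *)
Variable C : 'I_k -> {additive M -> {poly rat}}.
Hypothesis C_ann : forall r x,
  (forall i, pZQ (p i) %| pZQ r * C i x) -> r *: x = 0.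

(** If each p_i divides r q_i, then r kills every element whose i-th coordinate
    is divisible by q_i for each i.  These are sum_i deg q_i linear conditions,
    imposed here on the span of sum_i deg q_i + 1 elements: x and the t^l a_i
    with l < deg q_i. *)
Lemma annihilated_relation r (q : 'I_k -> {poly int}) x a :
    (forall i, q i != 0) ->
    (forall i, exists s, r * q i = s * p i) ->
  exists c : int, exists2 g : 'I_k -> {poly int},
    (forall i, (size (g i) < size (q i))%N) /\ (c != 0 \/ exists i, g i != 0)
    & r *: (x *~ c + \sum_i g i *: a i) = 0.
Proof.
move=> nz_q rq; pose J := {i : 'I_k & 'I_(size (q i)).-1}.
pose e (o : option J) := if o is Some t then 'X^(tagged t) *: a (tag t) else x.
pose A o (t : J) := (C (tag t) (e o) %% pZQ (q (tag t)))`_(tagged t).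
have [|v nz_v vA] := @int_relation (option J) J A; first by rewrite card_option.
pose w i (l : 'I_(size (q i)).-1) := v (Some (Tagged _ l)).
pose g i := poly_of_coefs (w i).
exists (v None); exists g; first split.
- move=> i; rewrite -[size (q i)]prednK ?size_poly_gt0 // ltnS.
  exact: size_poly_of_coefs.
- case: nz_v => -[[i l]|] nz_v; [right | by left].
  exists i; apply: contra nz_v => /eqP gi0; apply/eqP.
  by have := coef_poly_of_coefs (w i) l; rewrite -/(g i) gi0 coef0.
have -> : x *~ v None + \sum_i g i *: a i = \sum_o e o *~ v o.
  rewrite [RHS](bigD1 None) //=; congr (_ + _).
  rewrite (reindex_omap Some id) => [|[]] //=.
  transitivity (\sum_i \sum_(l < (size (q i)).-1) ('X^l *: a i) *~ w i l).
    apply: eq_bigr => i _; rewrite scaler_suml; apply: eq_bigr => l _.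
    by rewrite scalerMzl -scaler_int intz.
  rewrite sig_big_dep; apply: eq_big => [t|[i l] _] //=.
  by rewrite eqxx.
apply: C_ann => i; have [s rqE] := rq i.
have /dvdpP[z ->] : pZQ (q i) %| C i (\sum_o e o *~ v o).
  apply/modp_eq0P/polyP => l; rewrite coef0.
  have [lt_l|le_l] := ltnP l (size (q i)).-1; last first.
    rewrite nth_default // -ltnS (leq_trans (ltn_modpN0 _ _)) //.
      by rewrite -size_poly_eq0 size_pZQ size_poly_eq0.
    by rewrite size_pZQ (leq_trans (leqSpred _)).
  rewrite -[RHS](vA (Tagged _ (Ordinal lt_l))) raddf_sum.
  rewrite (big_morph _ (modpD _) (mod0p _)) coef_sum.
  apply: eq_bigr => o _.
  by rewrite raddfMz /A /= -scaler_int modpZl scaler_int coefMrz.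
by rewrite mulrCA -rmorphM rqE rmorphM mulrA dvdp_mull.
Qed.

Hypothesis p_dvd : forall i j, (i <= j)%N -> exists r, p i = r * p j.

(** The relation c a_m + sum_i g_i a_i killed by p_m comes from
    annihilated_relation with q_i = p_i / p_m for i < m, and with q_i = 1 for
    the other i since then p_i divides p_m already; q_i = 1 forces g_i = 0, so
    only the a_i with i < m occur.  Cancelling c uses that p_m is monic. *)
Lemma annihilated_mod_lower a m : poly_basis a ->
  exists w : 'I_k -> {poly int},
    p m *: a m = p m *: \sum_(i < k | (i < m)%N) w i *: a i.
Proof.
move=> [a_gen a_free].
have /fin_all_exists[q qP] i : exists q : {poly int},
    [/\ q != 0, exists s, p m * q = s * p i
      & if (i < m)%N then p i = q * p m else q = 1].
  have [lt_im|le_mi] := ltnP i m.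
    have [q pE] := p_dvd (ltnW lt_im); exists q; split=> //.
      have := monic_neq0 (p_monic i); rewrite pE.
      by apply: contraNneq => ->; rewrite mul0r.
    by exists 1; rewrite pE mulrC mul1r.
  have [r pE] := p_dvd le_mi; exists 1; split=> //; first exact: oner_neq0.
  by exists r; rewrite mulr1.
have [i|i|c [g [g_lt nz_cg] rel]] := @annihilated_relation (p m) q (a m) a.
- by have [] := qP i.
- by have [] := qP i.
have [u u_lt uE] := a_gen (p m *: a m).
have g_high i : ~~ (i < m)%N -> g i = 0.
  have [_ _] := qP i; case: ifP => // _ qi _.
  by apply/eqP; have := g_lt i; rewrite qi size_poly1 ltnS leqn0 size_poly_eq0.
(* deg g_i < deg q_i and p_i = p_m q_i, so the p_m g_i are coordinates. *)
have pg_lt i : (size (p m * g i)%R < size (p i))%N.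
  have [gi0|nz_g] := eqVneq (g i) 0.
    by rewrite gi0 mulr0 size_poly0 size_poly_gt0 monic_neq0.
  have lt_im : (i < m)%N by apply: contraNT nz_g => /g_high->.
  have [nz_q _] := qP i; rewrite lt_im => ->.
  rewrite mulrC !size_mul ?(monic_neq0 (p_monic m)) // ltn_predRL.
  rewrite prednK ?ltn_add2r //.
  by rewrite addn_gt0 size_poly_gt0 nz_g.
have ucg i : u i *~ c + p m * g i = 0.
  apply: (a_free (fun i => u i *~ c + p m * g i)) => [{}i|].
    rewrite (leq_ltn_trans (size_polyD _ _)) // gtn_max pg_lt andbT.
    by rewrite -scaler_int (leq_ltn_trans (size_scale_leq _ _)).
  rewrite -[RHS]rel scalerDr -scalerMzr uE scaler_sumr mulrz_suml -big_split.
  by apply: eq_bigr => l _; rewrite scalerDl scalerMzl scalerA.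
have nz_c : c != 0.
  case: nz_cg => // -[i]; apply: contraNneq => c0.
  have /eqP := ucg i; rewrite c0 mulr0z add0r mulf_eq0.
  by rewrite (negPf (monic_neq0 (p_monic m))).
have /fin_all_exists[w uw] i : exists w, u i = w * p m.
  apply: monic_dvdp_int => //.
  have: pZQ (p m) %| pZQ (u i *~ c).
    rewrite -[u i *~ c](addrK (p m * g i)) ucg sub0r rmorphN rmorphM.
    by rewrite dvdpNr dvdp_mulr.
  by rewrite rmorphMz /= -scaler_int dvdpZr // intr_eq0.
exists w; rewrite uE [in RHS]big_mkcond scaler_sumr; apply: eq_bigr => i _ /=.
case: ifPn => [_|/g_high gi]; first by rewrite scalerA mulrC -uw.
have /eqP := ucg i; rewrite gi mulr0 addr0 -mulrzr mulf_eq0.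
have -> : (c%:~R == 0 :> {poly int}) = false.
  rewrite -[c%:~R]/((1%:P : {poly int}) *~ c) -rmorphMz polyC_eq0 intz.
  exact: negPf.
by rewrite orbF => /eqP->; rewrite scale0r scaler0.
Qed.

Definition shift_generator a m (w : 'I_k -> {poly int}) i : M :=
  if i == m then a m - \sum_(l < k | (l < m)%N) w l *: a l else a i.

Lemma rmodp_scale i z x : p i *: x = 0 -> Pdiv.Ring.rmodp z (p i) *: x = z *: x.
Proof.
move=> pix; rewrite [in RHS](Pdiv.RingMonic.rdivp_eq (p_monic i) z).
by rewrite scalerDl -scalerA pix scaler0 add0r.
Qed.

(** Replacing a_m by a_m - sum_{l < m} w_l a_l changes coordinates by a
    unitriangular map: f_i becomes f_i - f_m w_i for i < m.  The product f_m w_i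
    can have too large a degree; as p_i a_i = 0 it may be reduced modulo p_i. *)
Lemma poly_basis_shift a m w : poly_basis a ->
  (forall i, (i < m)%N -> p i *: a i = 0) -> poly_basis (shift_generator a m w).
Proof.
move=> [a_gen a_free] a_ann.
pose z (f : {poly int}) i :=
  if (i < m)%N then Pdiv.Ring.rmodp (f * w i) (p i) else 0.
have z_lt f i : (size (z f i) < size (p i))%N.
  rewrite /z; case: ifP => _; last first.
    by rewrite size_poly0 size_poly_gt0 monic_neq0.
  by rewrite Pdiv.Ring.ltn_rmodpN0 ?monic_neq0.
have zm f : z f m = 0 by rewrite /z ltnn.
have shiftE f : \sum_i f i *: shift_generator a m w i =
    \sum_i (f i - z (f m) i) *: a i.
  under [RHS]eq_bigr do rewrite scalerBl.
  rewrite sumrB; rewrite (bigD1 m) // [in RHS](bigD1 m) //=.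
  rewrite {1}/shift_generator eqxx scalerBr addrAC; congr (_ + _ - _).
    by apply: eq_bigr => i /negPf ne_im; rewrite /shift_generator ne_im.
  rewrite scaler_sumr big_mkcond; apply: eq_bigr => i _ /=.
  rewrite /z; case: ifP => [lt_im|_]; last by rewrite scale0r.
  by rewrite rmodp_scale ?a_ann // scalerA.
split=> [x|f f_lt].
  have [f f_lt ->] := a_gen x; exists (fun i => f i + z (f m) i) => [i|].
    by rewrite (leq_ltn_trans (size_polyD _ _)) // gtn_max f_lt z_lt.
  by rewrite shiftE zm addr0; apply: eq_bigr => l _; rewrite addrK.
rewrite shiftE => /a_free fz0.
have {}fz0 i : f i - z (f m) i = 0.
  apply: fz0 => {}i.
  by rewrite (leq_ltn_trans (size_polyD _ _)) // size_polyN gtn_max f_lt z_lt.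
move=> i; have := fz0 m; rewrite zm subr0 => fm0.
by rewrite -[RHS](fz0 i) fm0 /z mul0r Pdiv.Ring.rmod0p if_same subr0.
Qed.

(** Induction on the number m of generators already corrected.  Correcting the
    m-th one leaves the previous ones fixed, so that the expressions of these in
    terms of the lower ones survive. *)
Lemma exists_annihilated_basis a : poly_basis a ->
  exists a', [/\ poly_basis a', forall i, p i *: a' i = 0
    & forall i, exists w : 'I_k -> {poly int},
        a' i = a i + \sum_(l < k | (l < i)%N) w l *: a' l].
Proof.
move=> a_basis.
suff /(_ k (leqnn k))[a' [a'_basis a'_ann a'E _]] :
    forall m : nat, (m <= k)%N ->
    exists a', [/\ poly_basis a', forall i, (i < m)%N -> p i *: a' i = 0,
      forall i, (i < m)%N -> exists w : 'I_k -> {poly int},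
        a' i = a i + \sum_(l < k | (l < i)%N) w l *: a' l
    & forall i, (m <= i)%N -> a' i = a i].
  by exists a'; split=> // i; [apply: a'_ann | apply: a'E].
elim=> [_|n IHn lt_nk]; first by exists a; split.
have [a' [a'_basis a'_ann a'E a'_high]] := IHn (ltnW lt_nk).
pose m := Ordinal lt_nk.
have [w pmE] := annihilated_mod_lower m a'_basis.
pose b := shift_generator a' m w.
have b_low i : i != m -> b i = a' i by rewrite /b /shift_generator => /negPf->.
have b_sum i (f : 'I_k -> {poly int}) : (i <= m)%N ->
    \sum_(l < k | (l < i)%N) f l *: b l = \sum_(l < k | (l < i)%N) f l *: a' l.
  move=> le_im; apply: eq_bigr => l lt_li; rewrite b_low //.
  by rewrite -val_eqE neq_ltn (leq_trans lt_li).
exists b; split=> [|i|i|i lt_ni].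
- exact: poly_basis_shift.
- rewrite ltnS leq_eqVlt -[n]/(val m) val_eqE => /orP[/eqP->|lt_im].
    by rewrite /b /shift_generator eqxx scalerBr pmE subrr.
  by rewrite b_low ?a'_ann // -val_eqE neq_ltn lt_im.
- rewrite ltnS leq_eqVlt -[n]/(val m) val_eqE => /orP[/eqP->|lt_im].
    exists (fun l => - w l); rewrite b_sum // -a'_high //.
    rewrite /b /shift_generator eqxx -sumrN.
    by congr (_ + _); apply: eq_bigr => l _; rewrite scaleNr.
  have [f fE] := a'E i lt_im; exists f.
  by rewrite b_sum 1?ltnW // b_low // -val_eqE neq_ltn lt_im.
- by rewrite b_low ?a'_high 1?ltnW // -val_eqE neq_ltn lt_ni orbT.
Qed.

End PolyBasis.

(** * Lattices with an endomorphism as Z[t]-modules *)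

Section Blocks.

Variables (H : vectType int) (h : {linear H -> H}).
Local Notation M := (tmodule h).

Lemma tmodule_scalec c (x : M) : c%:P *: x = c *: (x : H).
Proof. exact: tscaleC. Qed.

Lemma tmodule_scaleX (x : M) : 'X *: x = h x.
Proof. exact: tscaleX. Qed.

Lemma tmodule_scaleXn i (x : M) : 'X^i *: x = iter i h x.
Proof.
elim: i => [|i IHi]; first by rewrite expr0 scale1r.
by rewrite exprS -scalerA IHi tmodule_scaleX.
Qed.

Lemma tmodule_poly_of_coefs n (c : 'I_n -> int) (x : M) :
  \sum_(l < n) c l *: (iter l h x : H) = poly_of_coefs c *: x.
Proof.
rewrite scaler_suml; apply: eq_bigr => l _.
by rewrite -mul_polyC -scalerA tmodule_scaleXn tmodule_scalec.
Qed.

Variables (k : nat) (p : 'I_k -> {poly int}).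

Lemma tmodule_basis_sum (a : 'I_k -> M)
    (c : {j : 'I_k & 'I_(size (p j)).-1} -> int) :
  \sum_t c t *: (iter (tagged t) h (a (tag t)) : H) =
  \sum_j poly_of_coefs (fun l : 'I_(size (p j)).-1 => c (Tagged _ l)) *: a j.
Proof.
transitivity (\sum_j \sum_(l < (size (p j)).-1)
    c (Tagged _ l) *: (iter l h (a j) : H)).
  by rewrite sig_big_dep; apply: eq_big => [|[]].
by apply: eq_bigr => j _; rewrite tmodule_poly_of_coefs.
Qed.

Lemma zbasis_poly_basis (a : 'I_k -> M) : (forall j, p j \is monic) ->
  zbasis predT (fun t : {j : 'I_k & 'I_(size (p j)).-1} =>
                  iter (tagged t) h (a (tag t)) : H) ->
  poly_basis p a.
Proof.
move=> p_monic [a_gen a_free]; split=> [x|f f_lt].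
  have /a_gen[c ->] : (x : H) \in predT by [].
  rewrite tmodule_basis_sum; eexists; last reflexivity.
  move=> j; rewrite -[ltnRHS]prednK ?size_poly_gt0 ?monic_neq0 // ltnS.
  exact: size_poly_of_coefs.
have le_f j : (size (f j) <= (size (p j)).-1)%N.
  by rewrite -ltnS prednK // (leq_ltn_trans _ (f_lt j)).
move=> f0; have := a_free (fun t => (f (tag t))`_(tagged t)).
rewrite tmodule_basis_sum /=.
under eq_bigr => j _ do rewrite (poly_of_coefs_id (le_f j)).
move=> /(_ f0) f_coef j.
rewrite -(poly_of_coefs_id (le_f j)) /poly_of_coefs big1 // => l _.
by rewrite (f_coef (Tagged (fun i => 'I_(size (p i)).-1) l)) scale0r.
Qed.

(** * Companion blocks spanned by annihilated generators *)

Hypothesis p_monic : forall j, p j \is monic.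
Variable a : 'I_k -> M.
Hypotheses (a_basis : poly_basis p a) (a_ann : forall j, p j *: a j = 0).

Lemma poly_basis_inj (f g : 'I_k -> {poly int}) :
    (forall j, (size (f j) < size (p j))%N) ->
    (forall j, (size (g j) < size (p j))%N) ->
  \sum_j f j *: a j = \sum_j g j *: a j -> f =1 g.
Proof.
move=> f_lt g_lt eq_fg j; apply/eqP; rewrite -subr_eq0; apply/eqP.
apply: (a_basis.2 (fun j => f j - g j)) => [i|].
  by rewrite (leq_ltn_trans (size_polyD _ _)) // size_polyN gtn_max f_lt g_lt.
by under eq_bigr do rewrite scalerBl; rewrite sumrB eq_fg subrr.
Qed.

(** Membership in Z[t] a_j has to be a boolean predicate.  It is decided by
    choosing the coordinates of x and comparing x with its j-th component. *)
Lemma exists_blocks :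
  exists B : 'I_k -> {pred H}, forall j (x : H),
    x \in B j <-> exists f : {poly int}, x = f *: a j.
Proof.
have coordP (x : M) : exists f : {ffun 'I_k -> {poly int}},
    [forall i, (size (f i) < size (p i))%N] && (x == \sum_i f i *: a i).
  have [f f_lt xE] := a_basis.1 x; exists (finfun f); apply/andP; split.
    by apply/forallP => i; rewrite ffunE.
  by rewrite {1}xE; apply/eqP; apply: eq_bigr => i _; rewrite ffunE.
pose coord x := xchoose (coordP x).
exists (fun j (x : H) => x == coord x j *: a j :> M) => j x.
split=> [/eqP xE|[f xE]]; first by exists (coord x j).
have /andP[/forallP c_lt /eqP xE'] := xchooseP (coordP x).
pose r := Pdiv.Ring.rmodp f (p j).
have xr : x = r *: a j by rewrite xE rmodp_scale.
suff cE : coord x =1 (fun i => if i == j then r else 0).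
  by apply/eqP; rewrite cE eqxx.
apply: poly_basis_inj => // [i|].
  case: eqP => [->|_]; last by rewrite size_poly0 size_poly_gt0 monic_neq0.
  by rewrite Pdiv.Ring.ltn_rmodpN0 ?monic_neq0.
rewrite -xE' xr (bigD1 j) //= eqxx big1 ?addr0 // => i /negPf->.
by rewrite scale0r.
Qed.

Variable B : 'I_k -> {pred H}.
Hypothesis in_block : forall j (x : H),
  x \in B j <-> exists f : {poly int}, x = f *: a j.

Lemma block_remainder j (x : H) : x \in B j ->
  exists2 f : {poly int}, (size f < size (p j))%N & x = f *: a j.
Proof.
case/in_block => f ->; exists (Pdiv.Ring.rmodp f (p j)).
  by rewrite Pdiv.Ring.ltn_rmodpN0 ?monic_neq0.
by rewrite rmodp_scale.
Qed.

Lemma block_zbasis j :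
  zbasis (B j) (fun l : 'I_(size (p j)).-1 => iter l h (a j) : H).
Proof.
have le_lt (f : {poly int}) :
    (size f <= (size (p j)).-1)%N = (size f < size (p j))%N.
  by rewrite -ltnS prednK // size_poly_gt0 monic_neq0.
split=> [x|c]; first split=> [/block_remainder[f f_lt ->]|[c ->]].
- exists (fun l : 'I_(size (p j)).-1 => f`_l); rewrite tmodule_poly_of_coefs.
  by rewrite poly_of_coefs_id // le_lt.
- by apply/in_block; rewrite tmodule_poly_of_coefs; eexists.
rewrite tmodule_poly_of_coefs => c0 l.
rewrite -(coef_poly_of_coefs c) (_ : poly_of_coefs c = 0) ?coef0 //.
have := a_basis.2 (fun i => if i == j then poly_of_coefs c else 0).
move=> /(_ _ _ j); rewrite eqxx; apply=> [i|].
  case: eqP => [->|_]; last by rewrite size_poly0 size_poly_gt0 monic_neq0.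
  by rewrite -le_lt size_poly_of_coefs.
rewrite (bigD1 j) //= eqxx c0 big1 ?addr0 // => i /negPf->.
by rewrite scale0r.
Qed.

Lemma block_generated j : (1 < size (p j))%N -> generates_block h (B j) (a j).
Proof.
move=> p_gt1; exists (size (p j)).-1; last exact: block_zbasis.
by rewrite -subn1 subn_gt0.
Qed.

Lemma block_companion j : (1 < size (p j))%N -> companion_block h (B j).
Proof.
move=> p_gt1; split; last by exists (a j); apply: block_generated.
  split=> [|c x y /in_block[f ->] /in_block[g ->]]; apply/in_block.
    by exists 0; rewrite scale0r.
  by exists (c%:P * f + g); rewrite scalerDl -scalerA tmodule_scalec.
move=> x /in_block[f ->]; apply/in_block; exists ('X * f).
by rewrite -scalerA tmodule_scaleX.
Qed.

(** In the basis a_j, .., h^(d-1) a_j the matrix of h, with row vectors, is the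
    companion matrix of p_j, because p_j a_j = 0. *)
Lemma block_charpoly j : has_charpoly h (B j) (p j).
Proof.
exists (size (p j)).-1, (fun l => iter l h (a j)), (companionmx (p j)).
split; [exact: block_zbasis | | by rewrite companionmxK].
move=> i; rewrite tmodule_poly_of_coefs -iterS -tmodule_scaleXn.
set d := (size (p j)).-1 in i *.
have d_gt0 : (0 < d)%N by apply: leq_ltn_trans (ltn_ord i).
have [i_last|i_max] := eqVneq (i : nat) d.-1; last first.
  have lt_Si : (i.+1 < d)%N.
    rewrite ltn_neqAle ltn_ord andbT.
    by rewrite -(inj_eq succn_inj) prednK // in i_max.
  suff -> : poly_of_coefs (companionmx (p j) i) = 'X^(i.+1) by [].
  rewrite /poly_of_coefs (bigD1 (Ordinal lt_Si)) //= mxE (negPf i_max) /=.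
  rewrite eqxx scale1r big1 ?addr0 // => l ne_l.
  rewrite mxE (negPf i_max) eq_sym.
  by rewrite (_ : (l == i.+1 :> nat) = false) ?scale0r //; apply: negPf ne_l.
(* In the last row, t^d is replaced by t^d - p_j, which acts in the same way. *)
have -> : poly_of_coefs (companionmx (p j) i) = 'X^d - p j.
  rewrite -[p j in RHS](@poly_of_coefs_id d.+1) /poly_of_coefs; last first.
    exact: leqSpred.
  rewrite big_ord_recr /= -[(p j)`_d]/(lead_coef (p j)) (monicP (p_monic j)).
  rewrite scale1r opprD addrCA subrr addr0.
  by rewrite -sumrN; apply: eq_bigr => l _; rewrite mxE i_last eqxx scaleNr.
by rewrite scalerBl a_ann subr0 i_last prednK.
Qed.

Lemma block_decomposition : direct_decomposition B.
Proof.
move=> x; have [f f_lt xE] := a_basis.1 x.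
exists [ffun j => f j *: a j : H]; split.
  split=> [j|]; first by rewrite ffunE; apply/in_block; exists (f j).
  by rewrite [LHS]xE; apply: eq_bigr => j _; rewrite ffunE.
move=> y [yB xE']; apply/ffunP => j; rewrite ffunE.
have /fin_all_exists2[g g_lt gE] i := block_remainder (yB i).
rewrite gE (poly_basis_inj f_lt g_lt) // -[LHS]xE xE'.
by apply: eq_bigr => i _; rewrite gE.
Qed.

End Blocks.

(** * Coordinates in the rational cyclic decomposition *)

Lemma ratext_in_inj (H : vectType int) : injective (@ratext_in H).
Proof.
move=> x y eq_xy; apply: VectorInternalTheory.v2r_inj.
apply/matrixP => i j; move/matrixP/(_ i j): eq_xy; rewrite !mxE.
exact: intr_inj.
Qed.

Lemma ratext_in_scale (H : vectType int) (h : {linear H -> H}) (r : {poly int})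
    (x : tmodule h) :
  ratext_in (r *: x : H) =
    pZQ r *: (ratext_in x : tmodule (ratext_map h)) :> ratext H.
Proof.
rewrite [LHS](raddf_sum (@ratext_in H)) [RHS]/(tscale _ _) /tscale size_pZQ.
apply: eq_bigr => i _; rewrite coef_map.
have -> : iter i (ratext_map h) (ratext_in x) = ratext_in (iter i h x).
  by elim: (nat_of_ord i) => // l IHl; rewrite iterS IHl ratext_mapE.
by rewrite -[r`_i in LHS]intz !scaler_int raddfMz.
Qed.

(** The isomorphism of H_Q with the sum of the Q[t]/p_i, composed with the
    inclusion of H and with the choice of reduced representatives.  The property
    of C holds since the isomorphism and the inclusion are injective. *)
Lemma eldiv_coordinates (H : vectType int) (h : {linear H -> H}) (k : nat)
    (p : 'I_k -> {poly int}) :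
    elementary_divisors (tmodule (ratext_map h)) (fun j => pZQ (p j)) ->
  exists C : 'I_k -> {additive tmodule h -> {poly rat}},
    forall (r : {poly int}) (x : tmodule h),
      (forall i, pZQ (p i) %| pZQ r * C i x) -> r *: x = 0.
Proof.
case=> p_ok _ [F /bij_inj F_inj].
pose C i (x : tmodule h) : {poly rat} :=
  polyn (F (ratext_in (x : H)) i : {poly %/ pZQ (p i)}).
have CB i : zmod_morphism (C i).
  move=> x y; rewrite /C -[x - y]/((x : H) - (y : H)) raddfB.
  rewrite -[_ - _]/((ratext_in x : tmodule (ratext_map h)) - ratext_in y).
  by rewrite (raddfB F) !ffunE.
pose Cadd i := GRing.isZmodMorphism.Build _ _ (C i) (CB i).
pose C1 i : {additive tmodule h -> {poly rat}} := HB.pack (C i) (Cadd i).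
exists C1 => r x C_div; apply: ratext_in_inj.
rewrite [LHS]ratext_in_scale raddf0; apply: F_inj; rewrite linearZ raddf0.
apply/ffunP => i; rewrite !ffunE; apply: val_inj => /=.
have /andP[mon_p gt1_p] := p_ok i.
have mkE : mk_monic (pZQ (p i)) = pZQ (p i) by rewrite /mk_monic gt1_p mon_p.
move: (C_div i); rewrite -[polyn _]/(C1 i x); move: (C1 i x) => y.
by rewrite mkE Pdiv.RingMonic.rmodp_mulml // dvdpE => /eqP.
Qed.

Theorem theorem3p1 (H : vectType int) (h : {linear H -> H}) (k : nat)
    (p : 'I_k -> {poly int}) (a : 'I_k -> H)
    (rank_gt0 : (0 < dim H)%N)
    (p_eldiv : elementary_divisors (tmodule (ratext_map h))
                 (fun j => map_poly (intr : int -> rat) (p j)))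
    (a_basis : zbasis predT
                 (fun t : {j : 'I_k & 'I_(size (p j)).-1} =>
                    iter (tagged t) h (a (tag t)))) :
  exists B : 'I_k -> {pred H},
    [/\ standard_decomposition h B,
        forall j, has_charpoly h (B j) (p j),
        forall j : 'I_k, j = 0%N :> nat -> generates_block h (B j) (a j)
      & forall j : 'I_k, (0 < j)%N ->
          exists2 b, in_sum_before B j b & generates_block h (B j) (a j + b)].
Proof.
have [C C_ann] := eldiv_coordinates p_eldiv.
have [p_ok pQ_dvd _] := p_eldiv.
have p_monic j : p j \is monic by rewrite -pZQ_monic; case/andP: (p_ok j).
have p_gt1 j : (1 < size (p j))%N by rewrite -size_pZQ; case/andP: (p_ok j).
have p_dvd (i j : 'I_k) : (i <= j)%N -> exists r, p i = r * p j.
  by move=> le_ij; apply: monic_dvdp_int => //; apply: pQ_dvd.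
have [a' [a'_basis a'_ann a'E]] :=
  exists_annihilated_basis p_monic C_ann p_dvd
    (zbasis_poly_basis p_monic a_basis).
have [B in_block] := exists_blocks p_monic a'_basis a'_ann.
have charB := block_charpoly p_monic a'_basis a'_ann in_block.
have genB j := block_generated p_monic a'_basis a'_ann in_block (p_gt1 j).
exists B; split=> //.
- split; last by exists p.
    move=> j.
    exact: (block_companion p_monic a'_basis a'_ann in_block (p_gt1 j)).
  exact: (block_decomposition p_monic a'_basis a'_ann in_block).
- move=> j j0; have [w a'jE] := a'E j.
  have -> : a j = a' j by rewrite a'jE big_pred0 ?addr0 // => l; rewrite j0.
  exact: genB.
- move=> j _; have [w a'jE] := a'E j.
  exists (\sum_(l < k | (l < j)%N) w l *: a' l); last first.
    by have := genB j; rewrite a'jE.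
  by exists (fun l => w l *: a' l) => // l; apply/in_block; exists (w l).
Qed.
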